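(* Let $(S,\mathcal{S})$ be a measurable space with $\Delta\in\mathcal{S}\otimes\mathcal{S}$ and let $\pi$ be a constructive cr-set with independent increments. If $P(\pi\cap \{x\}\neq \emptyset)=0$ for all $x\in S$, then $\pi$ is a Poisson process.
   Context: $\Delta=\{(x,x)\mid x\in S\}$. $(\Omega,\mathcal{F},P)$ is a probability space; $C(S)$ is the set of countable subsets of $S$; $N_A(M)=|A\cap M|$; $\mathcal{C}(\mathcal{S})=\sigma(N_A\mid A\in\mathcal{S})$; a cr-set is an $\mathcal{F}$-$\mathcal{C}(\mathcal{S})$ measurable map $\Omega\to C(S)$, finite if its values are finite sets. A map $\tau:\Omega\to C(S)$ is constructive if $\tau(\omega)=\bigcup_k\pi_k(\omega)$ for all $\omega$ for some finite cr-sets $\pi_k$, $k\in\mathbb{N}$. A cr-set $\pi$ has independent increments if $N_{A_1}(\pi),\dots,N_{A_n}(\pi)$ are independent for all pairwise disjoint $A_1,\dots,A_n\in\mathcal{S}$. It is a Poisson process if moreover $N_A(\pi)$ has a Poisson distribution for every $A\in\mathcal{S}$, where $\delta_0$ and $\delta_\infty$ count as Poisson distributions. *)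

(* Defs.v *)
From HB Require Import structures.
From mathcomp Require Import all_boot all_order all_algebra finmap.
From mathcomp Require Import all_classical all_reals all_analysis.
Set Implicit Arguments. Unset Strict Implicit. Unset Printing Implicit Defensive.
Import Order.TTheory GRing.Theory Num.Theory.
Local Open Scope classical_set_scope.
Local Open Scope ring_scope.

(* N_A(M) = |A ∩ M| in ℕ ∪ {∞}; [None] encodes ∞. *)
Definition Ncount {T : choiceType} (A M : set T) : option nat :=
  if pselect (finite_set (A `&` M)) then Some #|` fset_set (A `&` M)|%fset
  else None.

(* Generators of C(S): preimages N_A^{-1}(B), A ∈ 𝒮, B ⊆ ℕ ∪ {∞}
   (ℕ ∪ {∞} carries its discrete σ-algebra). *)
Definition Ngen {d} {S : measurableType d} : set (set (set S)) :=
  [set C | exists A (B : set (option nat)),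
      measurable A /\ C = (fun M => Ncount A M) @^-1` B].

(* cr-set: a map Ω -> C(S) which is F-C(S) measurable, where
   C(S) = σ(N_A | A ∈ 𝒮) (on C(S); equivalently its trace on countable sets). *)
Definition crset {dO d} {Omega : measurableType dO} {S : measurableType d}
  (pi : Omega -> set S) : Prop :=
  (forall w, countable (pi w)) /\
  (forall C, <<s Ngen >> C -> measurable (pi @^-1` C)).

Definition finite_crset {dO d} {Omega : measurableType dO} {S : measurableType d}
  (pi : Omega -> set S) : Prop :=
  crset pi /\ (forall w, finite_set (pi w)).

Definition constructive {dO d} {Omega : measurableType dO} {S : measurableType d}
  (tau : Omega -> set S) : Prop :=
  exists pik : nat -> Omega -> set S,
    (forall k, finite_crset (pik k)) /\
    (forall w, tau w = \bigcup_k pik k w).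

Definition independent_increments {dO d} {Omega : measurableType dO}
  {S : measurableType d} {R : realType} (P : probability Omega R)
  (pi : Omega -> set S) : Prop :=
  forall (n : nat) (A : 'I_n -> set S),
    (forall i, measurable (A i)) ->
    (forall i j, i != j -> A i `&` A j = set0) ->
    forall B : 'I_n -> set (option nat),
      P (\bigcap_(i in [set: 'I_n]) [set w | B i (Ncount (A i) (pi w))])
      = (\prod_(i < n) P [set w | B i (Ncount (A i) (pi w))])%E.

(* The law of X : Omega -> ℕ ∪ {∞} is Poisson(λ) with λ ∈ [0, ∞]
   (λ = 0 gives δ_0, λ = ∞ gives δ_∞). *)
Definition poisson_law {dO} {Omega : measurableType dO} {R : realType}
  (P : probability Omega R) (X : Omega -> option nat) : Prop :=
  (exists lam : R, 0 <= lam /\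
     forall k : nat,
       P [set w | X w = Some k] = (expR (- lam) * lam ^+ k / k`!%:R)%:E)
  \/ P [set w | X w = None] = 1%E.

Definition poisson_process {dO d} {Omega : measurableType dO}
  {S : measurableType d} {R : realType} (P : probability Omega R)
  (pi : Omega -> set S) : Prop :=
  crset pi /\ independent_increments P pi /\
  forall A, measurable A -> poisson_law P (fun w => Ncount A (pi w)).

(* Main.v *)
(* Write v(B) = P(pi ∩ B = ∅). Independence makes v multiplicative over finite
   measurable partitions, and measurability of the diagonal provides countably
   many measurable sets E_0, E_1, ... separating the points of S, hence finer
   and finer finite partitions of a set A into cells.

   If v(A) > 0, then the cells have v uniformly close to 1, because points carry
   no mass. The number of cells hit by pi is a sum of independent indicators; its
   law is v(A) times the elementary symmetric polynomials in the odds
   1/v(cell) - 1, which converge to (-ln v(A))^k / k!. These numbers increase to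
   N_A(pi), which is therefore Poisson with parameter -ln v(A).

   If v(A) = 0, then v vanishes along a branch B_n of cells shrinking to at most
   one point, while v(A \ B_n) tends to v(A) = 0: for large n, pi has a point in
   A \ B_n with probability close to 1, so that by induction on k at least k + 1
   points of pi lie in A almost surely. *)
Require Import Defs.
From HB Require Import structures.
From mathcomp Require Import all_boot all_order all_algebra finmap.
From mathcomp Require Import all_classical all_reals all_analysis.
From mathcomp Require Import ring lra.
Set Implicit Arguments. Unset Strict Implicit. Unset Printing Implicit Defensive.
Import Order.TTheory GRing.Theory Num.Theory.
Import numFieldNormedType.Exports.
Local Open Scope classical_set_scope.
Local Open Scope ring_scope.

(** * Elementary symmetric polynomials and their limits *)

Section elementary_symmetric.
Variable R : realType.

Definition elem_sym (T : finType) (b : T -> R) (k : nat) : R :=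
  \sum_(J : {set T} | #|J| == k) \prod_(t in J) b t.

Lemma elem_sym0 (T : finType) (b : T -> R) : elem_sym b 0 = 1.
Proof.
rewrite /elem_sym (big_pred1 (finset.set0 : {set T})) ?big_set0//.
by move=> J; rewrite finset.cards_eq0.
Qed.

(** Double counting of pairs of a set of size [k.+1] and one of its elements: removing the element
    leaves a set of size [k] and a point outside it. *)
Lemma elem_symS (T : finType) (b : T -> R) k :
  k.+1%:R * elem_sym b k.+1 =
  \sum_(J : {set T} | #|J| == k) (\prod_(t in J) b t) * \sum_(t | t \notin J) b t.
Proof.
transitivity (\sum_(J : {set T} | #|J| == k.+1) \sum_(t in J) \prod_(u in J) b u).
  rewrite /elem_sym mulr_sumr; apply: eq_bigr => J /eqP cJ.
  by rewrite sumr_const cJ mulr_natl.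
under [RHS]eq_bigr do rewrite mulr_sumr.
rewrite (exchange_big_dep predT)//= [RHS](exchange_big_dep predT)//=.
apply: eq_bigr => t _.
rewrite (reindex_onto (fun J : {set T} => (t |: J)%SET) (fun J : {set T} => (J :\ t)%SET)) /=; last first.
  by move=> J /andP[_ tJ]; rewrite finset.setD1K.
apply: eq_big => [J|J /andP[_ /eqP tJ]].
  rewrite finset.setU11 andbT; case: (boolP (t \in J)) => tJ /=.
    rewrite andbF; apply/negP => /andP[_ /eqP JE].
    by move: tJ; rewrite -JE !inE eqxx.
  by rewrite andbT finset.setU1K// eqxx andbT finset.cardsU1 tJ eqSS.
have tnJ : t \notin J by rewrite -tJ !inE eqxx.
by rewrite finset.big_setU1// mulrC.
Qed.

Lemma elem_symS_le (T : finType) (b : T -> R) k : (forall t, 0 <= b t) ->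
  k.+1%:R * elem_sym b k.+1 <= (\sum_t b t) * elem_sym b k.
Proof.
move=> b0; rewrite elem_symS mulrC /elem_sym mulr_suml; apply: ler_sum => J _.
apply: ler_wpM2l; first exact: prodr_ge0.
by rewrite [leRHS](bigID (mem J)) /= lerDr sumr_ge0.
Qed.

(** The terms with [t] in [J], which the inner sum of [elem_symS] leaves out, add up to at most
    [k * beta]. *)
Lemma elem_symS_ge (T : finType) (b : T -> R) (beta : R) k :
  (forall t, 0 <= b t <= beta) ->
  (\sum_t b t - k%:R * beta) * elem_sym b k <= k.+1%:R * elem_sym b k.+1.
Proof.
move=> b0; rewrite elem_symS mulrC /elem_sym mulr_suml; apply: ler_sum => J /eqP cJ.
apply: ler_wpM2l; first by apply: prodr_ge0 => t _; have /andP[] := b0 t.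
rewrite (bigID (mem J)) /= addrAC gerDr subr_le0 -cJ mulr_natl -sumr_const.
by apply: ler_sum => t _; have /andP[] := b0 t.
Qed.

(** Induction on [k]: since [k * beta n] vanishes in the limit, the two preceding bounds squeeze the
    polynomial of degree [k.+1] to [lam / k.+1] times the limit in degree [k]. *)
Lemma elem_sym_cvg (T : nat -> finType) (b : forall n, T n -> R)
    (beta : nat -> R) (lam : R) :
  (forall n t, 0 <= b n t <= beta n) ->
  beta @ \oo --> (0 : R) -> (fun n => \sum_t b n t) @ \oo --> lam ->
  forall k, (fun n => elem_sym (b n) k) @ \oo --> lam ^+ k / k`!%:R.
Proof.
move=> b0 beta0 slam; elim=> [|k IH].
  rewrite expr0 fact0 divr1.
  under eq_fun do rewrite elem_sym0; exact: cvg_cst.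
have lim : (lam - k%:R * 0) * (lam ^+ k / k`!%:R) / k.+1%:R = lam ^+ k.+1 / k.+1`!%:R.
  by rewrite mulr0 subr0 factS natrM invfM exprS !mulrA [RHS]mulrAC.
apply: (@squeeze_cvgr _ _ _ _
  (fun n => (\sum_t b n t - k%:R * beta n) * elem_sym (b n) k / k.+1%:R)
  (fun n => (\sum_t b n t) * elem_sym (b n) k / k.+1%:R)).
- apply: nearW => n; rewrite ler_pdivrMr ?ltr0n// ler_pdivlMr ?ltr0n//.
  rewrite ![_ * k.+1%:R]mulrC elem_symS_ge// elem_symS_le//.
  by move=> t; have /andP[] := b0 n t.
- rewrite -lim; apply: cvgMr_tmp; apply: cvgM IH; apply: cvgB => //.
  exact: cvgMl_tmp.
- rewrite -lim mulr0 subr0; apply: cvgMr_tmp; exact: cvgM IH.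
Qed.

End elementary_symmetric.

(** * Counting points and counting hit cells *)

Definition below (k : nat) (o : option nat) : bool :=
  if o is Some n then (n < k)%N else false.

(** Lists of distinct points treat finite and infinite counts alike, as [None] is below no [k].
    [hits_geP] has the same form, with points in distinct cells, so that the two counts can be
    compared. *)
Lemma Ncount_belowPn (T : choiceType) (A M : set T) k :
  ~~ below k (Ncount A M) <->
  exists s : seq T, [/\ size s = k, uniq s & forall x, x \in s -> (M `&` A) x].
Proof.
rewrite setIC /Ncount; case: pselect => [fin|inf] /=.
  rewrite -leqNgt; split=> [le|[s [<- us sAM]]].
    exists (take k (fset_set (A `&` M))).
    rewrite size_takel// take_uniq ?fset_uniq//; split=> // x /mem_take.
    by rewrite in_fset_set// inE.
  by apply: uniq_leq_size us _ => x /sAM xAM; rewrite in_fset_set// inE.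
split=> // _; have [B BAM kB] := infinite_set_fset k inf.
exists (take k B); rewrite size_takel// take_uniq ?fset_uniq//; split=> // x /mem_take.
exact: BAM.
Qed.

Lemma Ncount_eq0 (T : choiceType) (A M : set T) :
  Ncount A M = Some 0%N <-> M `&` A = set0.
Proof.
have H := Ncount_belowPn A M 1; split=> [N0|MA0].
  apply: contrapT => /eqP/set0P [x MAx].
  have /H : exists s : seq T, [/\ size s = 1%N, uniq s & forall x, x \in s -> (M `&` A) x].
    by exists [:: x]; split=> // y; rewrite inE => /eqP ->.
  by rewrite N0.
case NE : Ncount H => [[//|n]|] [H _];
  by have [[|x s] [] // _ _ /(_ x (mem_head _ _))] := H isT; rewrite MA0.
Qed.

Section cells.
Context (S : pointedType) (T : finType) (g : S -> T).

Definition cell (A : set S) (t : T) : set S := A `&` g @^-1` [set t].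

Definition hits (A M : set S) : {set T} :=
  [set t | `[< M `&` cell A t !=set0 >]]%SET.

Lemma hits_geP (A M : set S) k : (k <= #|hits A M|)%N <->
  exists s : seq S, [/\ size s = k, uniq (map g s) & forall x, x \in s -> (M `&` A) x].
Proof.
split=> [le|[s [<- us sMA]]]; last first.
  rewrite -(size_map g) cardE; apply: uniq_leq_size us _ => _ /mapP[x /sMA [Mx Ax] ->].
  by rewrite mem_enum inE; apply/asboolP; exists x.
(* Choose a point of [M] in every hit cell; for the other cells [point] is a dummy value. *)
have /choice[f fP] : forall t, exists x, t \in hits A M -> (M `&` A) x /\ g x = t.
  move=> t; case: (boolP (t \in hits A M)) => [|_].
    by rewrite inE => /asboolP[x [Mx [Ax gx]]]; exists x.
  by exists point.
exists (map f (take k (enum (hits A M)))).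
have tk t : t \in take k (enum (hits A M)) -> t \in hits A M.
  by move=> /mem_take; rewrite mem_enum.
split; first by rewrite size_map size_takel// -cardE.
  rewrite -map_comp map_id_in ?take_uniq ?enum_uniq//.
  by move=> t /tk /fP [].
by move=> _ /mapP[t /tk /fP [? _] ->].
Qed.

Lemma hits_eq0 (A M : set S) : hits A M = finset.set0 <-> M `&` A = set0.
Proof.
split=> [h0|MA0].
  apply: contrapT => /eqP/set0P [x [Mx Ax]].
  have : g x \in hits A M by rewrite inE; apply/asboolP; exists x.
  by rewrite h0 inE.
apply/setP => t; rewrite !inE; apply/asboolP => -[x [Mx [Ax _]]].
by have : (M `&` A) x by []; rewrite MA0.
Qed.

End cells.

(** * Separating sequences and the partitions they generate *)

Section separating.
Context (d : measure_display) (S : measurableType d).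

Definition separating (E : nat -> set S) :=
  (forall n, measurable (E n)) /\ (forall x y, (forall n, E n x <-> E n y) -> x = y).

(* The sets D whose sections are saturated for countably many measurable sets
   form a sigma-algebra containing the rectangles; the sections of the diagonal
   are the points. *)
Lemma diagonal_separating :
  measurable (diagonal : set (S * S)) -> exists E, separating E.
Proof.
pose G : set (set (S * S)) := [set D | exists E : nat -> set S,
  (forall n, measurable (E n)) /\
  forall x y y', (forall n, E n y <-> E n y') -> D (x, y) -> D (x, y')].
have GD : ((d, d).-prod.-measurable : set (set (S * S))) `<=` G.
  rewrite measurable_prod_measurableType; apply: smallest_sub; last first.
    move=> _ [A mA] [B mB] <-; exists (fun=> B); split=> // x y y' /(_ 0%N) By [/= Ax].
    by move=> /By.
  split=> [|D [E [mE ED]]|F GF].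
  - by exists (fun=> set0); split.
  - exists E; split=> // x y y' Ey [_ nD]; split=> // Dy'; apply: nD.
    by apply: ED Dy' => n; split=> /Ey.
  - have [E hE] := choice GF.
    (* The countably many sequences are merged into one through a numbering of pairs; numbers that
       code no pair get [set0]. *)
    exists (fun m => if @choice.unpickle (nat * nat)%type m is Some ij then E ij.1 ij.2 else set0); split.
      by move=> m; case: choice.unpickle => // ij; exact: (hE _).1.
    move=> x y y' Ey [i _ Fi]; exists i => //; apply: (hE i).2 Fi => n.
    by have := Ey (choice.pickle (i, n)); rewrite choice.pickleK.
move=> /GD [E [mE ED]]; exists E; split=> // x y Exy.
exact: (ED x x y).
Qed.

(** Cut successively by [E 0], [E 1], ... and keep a bad half each time. Two points in every [B n]
    lie on the same side of every [E n], hence coincide. The lemma serves twice: for sets without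
    fine partitions and for sets of void probability 0. *)
Lemma separating_branch (E : nat -> set S) (bad : set S -> Prop) (A : set S) :
  separating E -> measurable A -> bad A ->
  (forall B n, measurable B -> B `<=` A -> bad B ->
    bad (B `&` E n) \/ bad (B `\` E n)) ->
  exists B : nat -> set S,
    [/\ forall n, measurable (B n) /\ B n `<=` A, forall n, bad (B n), nonincreasing_seq B &
        forall x y, (forall n, B n x) -> (forall n, B n y) -> x = y].
Proof.
move=> [mE sepE] mA badA split_bad.
pose B := fix B (n : nat) : set S := if n is m.+1 then
  if pselect (bad (B m `&` E m)) then B m `&` E m else B m `\` E m else A.
have BP n : [/\ measurable (B n), B n `<=` A & bad (B n)].
  elim: n => [|n [mB BA badB]] /=; first by split.
  case: pselect => [?|nbad]; split=> //.
  - exact: measurableI.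
  - by move=> x [/BA].
  - exact: measurableD.
  - by move=> x [/BA].
  - by case: (split_bad (B n) n mB BA badB).
exists B; split=> [n|n||x y Bx By].
- by have [] := BP n.
- by have [] := BP n.
- by apply/nonincreasing_seqP => n; apply/subsetPset => x /=; case: pselect => ? [].
apply: sepE => n; have := Bx n.+1; have := By n.+1 => /=.
by case: pselect => _ [_ ?] [_ ?]; split.
Qed.

Section code.
Variable E : nat -> set S.

(** The nonempty fibres of [code n] are the atoms of the algebra generated by the first [n] sets. *)
Definition code (n : nat) (x : S) : {ffun 'I_n -> bool} :=
  [ffun i : 'I_n => `[< E i x >]].

Lemma codeP n x y : code n x = code n y <-> forall i, (i < n)%N -> (E i x <-> E i y).
Proof.
split=> [/ffunP exy i ltin|exy].
  have := exy (Ordinal ltin); rewrite !ffunE /= => e.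
  by split=> h; apply/asboolP; [rewrite -e|rewrite e]; apply/asboolP.
by apply/ffunP => i; rewrite !ffunE; apply: asbool_equiv_eq; exact: exy.
Qed.

Lemma code_leq n m x y : (n <= m)%N -> code m x = code m y -> code n x = code n y.
Proof. by move=> nm /codeP exy; apply/codeP => i /leq_trans/(_ nm)/exy. Qed.

Lemma uniq_code_leq n m s : (n <= m)%N -> uniq (map (code n) s) -> uniq (map (code m) s).
Proof.
move=> nm; elim: s => //= x s IH /andP[xs us]; rewrite IH// andbT.
by apply: contra xs => /mapP[y ys /(code_leq nm) ->]; exact: map_f.
Qed.

Hypothesis sepE : separating E.

Lemma measurable_code n t : measurable (code n @^-1` [set t]).
Proof.
have -> : code n @^-1` [set t] =
    \bigcap_(i in [set: 'I_n]) (if t i then E i else ~` E i).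
  apply/seteqP; split=> [x /= <- i _|x Ex].
    by rewrite ffunE; case: asboolP.
  apply/ffunP => i; rewrite ffunE; have := Ex i I.
  case: (t i) => /= Eix; first exact: asboolT Eix.
  exact: asboolF Eix.
apply: fin_bigcap_measurable => // i _.
by case: (t i); [|apply: measurableC]; apply: sepE.1.
Qed.

(** Finitely many pairs of points are separated by finitely many sets, and longer codes keep
    separated points apart. *)
Lemma separating_code s : uniq s -> exists n, uniq (map (code n) s).
Proof.
elim: s => [|x s IH] /=; first by exists 0%N.
move=> /andP[xs /IH [n us]].
suff [m xm] : exists m, code m x \notin map (code m) s.
  exists (maxn n m); rewrite (uniq_code_leq (leq_maxl n m) us) andbT.
  apply: contra xm => /mapP[y ys /(code_leq (leq_maxr n m)) ->]; exact: map_f.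
elim: s xs {IH us} => [|y s IH]; first by exists 0%N.
rewrite inE negb_or => /andP[xy /IH [m xm]].
have [i Ei] : exists i, ~ (E i x <-> E i y).
  apply/existsNP => Exy; move/eqP: xy; apply; exact: sepE.2.
exists (maxn i.+1 m); rewrite inE negb_or; apply/andP; split.
  by apply/eqP => /codeP/(_ i)/(_ (leq_maxl _ _)).
apply: contra xm => /mapP[z zs /(code_leq (leq_maxr i.+1 m)) ->]; exact: map_f.
Qed.

End code.

End separating.

(** * Probabilities as real numbers *)

Section real_probability.
Context (d : measure_display) (Omega : measurableType d) (R : realType).
Variable P : probability Omega R.

Definition pr (X : set Omega) : R := fine (P X).

Lemma prE X : measurable X -> P X = (pr X)%:E.
Proof. by move=> mX; rewrite /pr fineK// fin_num_measure. Qed.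

Lemma pr_ge0 X : 0 <= pr X.
Proof. exact: fine_ge0. Qed.

Lemma pr_le X Y : measurable X -> measurable Y -> X `<=` Y -> pr X <= pr Y.
Proof.
by move=> mX mY XY; rewrite -lee_fin -!prE// le_measure// inE.
Qed.

Lemma pr_le1 X : measurable X -> pr X <= 1.
Proof. by move=> mX; rewrite -lee_fin -prE// probability_le1. Qed.

Lemma pr_setC X : measurable X -> pr (~` X) = 1 - pr X.
Proof.
move=> mX; apply: EFin_inj; rewrite -prE; last exact: measurableC.
by rewrite probability_setC// prE.
Qed.

Lemma pr_setU_le X Y : measurable X -> measurable Y -> pr (X `|` Y) <= pr X + pr Y.
Proof.
move=> mX mY; rewrite -lee_fin EFinD -!prE//; last exact: measurableU.
exact: measureU2.
Qed.

Lemma pr_setU X Y : measurable X -> measurable Y -> X `&` Y = set0 ->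
  pr (X `|` Y) = pr X + pr Y.
Proof.
move=> mX mY XY0; apply: EFin_inj; rewrite EFinD -!prE//; last exact: measurableU.
exact: measureU.
Qed.

Lemma pr_cvg (F : nat -> set Omega) :
  (forall n, measurable (F n)) -> nonincreasing_seq F ->
  (fun n => pr (F n)) @ \oo --> pr (\bigcap_n F n).
Proof.
move=> mF decF; have mI : measurable (\bigcap_n F n) by exact: bigcapT_measurable.
apply: fine_cvg; rewrite -prE//.
by apply: nonincreasing_cvg_mu => //; apply: le_lt_trans (probability_le1 P (mF 0%N)) (ltry _).
Qed.

Lemma pr_finType (I : finType) (h : Omega -> I) (p : pred I) :
  (forall i, measurable (h @^-1` [set i])) ->
  measurable [set w | p (h w)] /\
  pr [set w | p (h w)] = \sum_(i | p i) pr (h @^-1` [set i]).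
Proof.
move=> mh.
have -> : [set w | p (h w)] = \bigcup_(i in [set` p]) (h @^-1` [set i]).
  by apply/seteqP; split=> [w pw|w [i pi /= ->]//]; exists (h w).
have fin_p : finite_set [set` p] by exact: finite_finset.
split; first exact: fin_bigcup_measurable.
apply: EFin_inj; rewrite -prE; last exact: fin_bigcup_measurable.
have tI : trivIset [set` p] (fun i => h @^-1` [set i]).
  by move=> i j _ _ [w [/= <- <-]].
rewrite measure_fin_bigcup//.
rewrite -sumEFin (fsbigE (enum p)) ?enum_uniq//.
- transitivity (\sum_(i <- enum p) (pr (h @^-1` [set i]))%:E)%E; last exact: big_enum.
  rewrite big_seq_cond [RHS]big_seq_cond.
  apply: eq_big => [i|i _]; last exact: prE.
  by apply: andb_id2l; rewrite mem_enum => pi; apply: mem_set.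
- by move=> i; rewrite /= mem_enum.
- by move=> i /= pi; rewrite mem_enum pi.
Qed.

End real_probability.

(** * Void probabilities and the law of the set of hit cells *)

Section process.
Context (d dO : measure_display) (S : measurableType d) (Omega : measurableType dO).
Context (R : realType) (P : probability Omega R) (pi : Omega -> set S).
Hypothesis cr_pi : crset pi.
Hypothesis indep_pi : independent_increments P pi.

Definition avoid (A : set S) : set Omega := [set w | pi w `&` A = set0].

Let v (A : set S) : R := pr P (avoid A).

Lemma measurable_Ncount (A : set S) (B : set (option nat)) :
  measurable A -> measurable [set w | B (Ncount A (pi w))].
Proof.
move=> mA; apply: (cr_pi.2 ((fun M => Ncount A M) @^-1` B)).
by apply: sub_sigma_algebra; exists A, B.
Qed.

Lemma avoidE A : avoid A = [set w | [set Some 0%N] (Ncount A (pi w))].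
Proof. by apply/seteqP; split=> w /Ncount_eq0. Qed.

Lemma measurable_avoid A : measurable A -> measurable (avoid A).
Proof. by rewrite avoidE; exact: measurable_Ncount. Qed.

Lemma pr_avoid_le A B : measurable A -> measurable B -> A `<=` B -> v B <= v A.
Proof.
move=> mA mB piAB; apply: pr_le; [exact: measurable_avoid..|].
by move=> w piB; rewrite /avoid /mkset -classical_sets.subset0 -piB; exact: classical_sets.setIS.
Qed.

Lemma pr_avoid_le1 A : measurable A -> v A <= 1.
Proof. by move=> mA; apply: pr_le1; exact: measurable_avoid. Qed.

Lemma independent_finType (T : finType) (A : T -> set S) (B : T -> set (option nat)) :
  (forall t, measurable (A t)) -> (forall t u, t != u -> A t `&` A u = set0) ->
  measurable (\bigcap_t [set w | B t (Ncount (A t) (pi w))]) /\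
  pr P (\bigcap_t [set w | B t (Ncount (A t) (pi w))]) =
  \prod_t pr P [set w | B t (Ncount (A t) (pi w))].
Proof.
move=> mA disjA.
have mI : measurable (\bigcap_t [set w | B t (Ncount (A t) (pi w))]).
  by apply: fin_bigcap_measurable => // t _; exact: measurable_Ncount.
split=> //; apply: EFin_inj; rewrite -prE// -prodEFin.
have -> : \bigcap_t [set w | B t (Ncount (A t) (pi w))] =
    \bigcap_(i in [set: 'I_#|T|])
      [set w | B (enum_val i) (Ncount (A (enum_val i)) (pi w))].
  apply/seteqP; split=> w Bw => [i _|t _]; first exact: Bw.
  by have := Bw (enum_rank t) I; rewrite /= enum_rankK.
rewrite (indep_pi (A := fun i : 'I_#|T| => A (enum_val i)) _ _ (fun i => B (enum_val i)))//.
  2: by move=> i j ij; apply: disjA; apply: contra ij => /eqP/enum_val_inj ->.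
rewrite [RHS](reindex (@enum_val T T))/=; last exact/onW_bij/enum_val_bij.
by apply: eq_bigr => i _; rewrite prE//; exact: measurable_Ncount.
Qed.

Section hits_law.
Context (T : finType) (g : S -> T) (A : set S).
Hypotheses (mg : forall t, measurable (g @^-1` [set t])) (mA : measurable A).

Lemma measurable_cell t : measurable (cell g A t).
Proof. exact: measurableI. Qed.

(** That exactly the cells in [J] are hit prescribes, for each cell separately, whether its count is
    zero; the cells are disjoint, so independence gives a product. *)
Lemma hits_law (J : {set T}) :
  measurable ((hits g A \o pi) @^-1` [set J]) /\
  pr P ((hits g A \o pi) @^-1` [set J]) =
  \prod_t (if t \in J then 1 - v (cell g A t) else v (cell g A t)).
Proof.
pose B t : set (option nat) := if t \in J then ~` [set Some 0%N] else [set Some 0%N].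
have -> : (hits g A \o pi) @^-1` [set J] =
    \bigcap_t [set w | B t (Ncount (cell g A t) (pi w))].
  apply/seteqP; split=> [w /= hJ t _|w Bw] /=.
    have := in_setE; rewrite /B -hJ inE; case: asboolP => [ne0|e0] _ /=.
      by move/Ncount_eq0/eqP; apply/negP; exact/set0P.
    by apply/Ncount_eq0; apply: contrapT => /eqP/set0P.
  apply/setP => t; have := Bw t I; rewrite /B /= inE.
  case: ifPn => _ /=; [move=> N0; apply/asboolP/set0P/eqP|move/Ncount_eq0 => N0].
    by move=> /Ncount_eq0.
  by apply/asboolP => /set0P; rewrite N0 eqxx.
have disj t u : t != u -> cell g A t `&` cell g A u = set0.
  move=> /eqP tu; rewrite -classical_sets.subset0 => x [[_ gt] [_ gu]].
  by apply: tu; rewrite -gt -gu.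
have [mI ->] := @independent_finType T (cell g A) B measurable_cell disj.
split=> //; apply: eq_bigr => t _; rewrite /B; case: ifPn => _; last by rewrite -avoidE.
by rewrite -pr_setC ?avoidE//; exact: measurable_Ncount (measurable_cell t).
Qed.

Lemma pr_avoid_partition : v A = \prod_t v (cell g A t).
Proof.
(* To avoid [A] is to hit none of its cells. *)
have [_] := hits_law finset.set0.
have -> : (hits g A \o pi) @^-1` [set finset.set0] = avoid A.
  by apply/seteqP; split=> w; [move/hits_eq0 | move=> A0; apply/hits_eq0].
by rewrite /v => ->; apply: eq_bigr => t _; rewrite inE.
Qed.

(* Dividing by v(A) turns the law of the set of hit cells into a product of odds. *)
Lemma pr_card_hits k : 0 < v A ->
  measurable [set w | (#|hits g A (pi w)| < k)%N] /\
  pr P [set w | (#|hits g A (pi w)| < k)%N] =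
  v A * \sum_(i < k) elem_sym (fun t => (v (cell g A t))^-1 - 1) i.
Proof.
move=> vA0.
have v0 t : v (cell g A t) != 0.
  rewrite gt_eqF// (lt_le_trans vA0)//.
  by apply: pr_avoid_le => //; [exact: measurable_cell|move=> x []].
have [mh ->] := @pr_finType _ _ _ P _ (hits g A \o pi) (fun J => #|J| < k)%N
  (fun J => (hits_law J).1).
split=> //; rewrite mulr_sumr /elem_sym.
under [RHS]eq_bigr do rewrite mulr_sumr.
rewrite (exchange_big_dep (fun J : {set T} => #|J| < k)%N)/=; last first.
  by move=> i J _ /eqP ->.
apply: eq_bigr => J Jk; rewrite (big_pred1 (Ordinal Jk))//.
rewrite (hits_law J).2 [in RHS]pr_avoid_partition [X in _ * X]big_mkcond -big_split /=.
apply: eq_bigr => t _; case: ifP => _; last by rewrite mulr1.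
by rewrite mulrBr mulr1 mulfV.
Qed.

End hits_law.

Lemma pr_avoid_split A B : measurable A -> measurable B ->
  v A = v (A `&` B) * v (A `\` B).
Proof.
move=> mA mB; pose g x := `[< B x >].
have gT : g @^-1` [set true] = B by apply/seteqP; split=> x /asboolP.
have gF : g @^-1` [set false] = ~` B.
  by apply/seteqP; split=> x; rewrite /g/=; case: asboolP.
rewrite (@pr_avoid_partition _ g)//; last by case; rewrite ?gT ?gF//; exact: measurableC.
by rewrite big_bool /cell gT gF.
Qed.

(** * Limits along refining partitions when points are null *)

Section null_points.
Hypothesis null_pi : forall x : S, P [set w | pi w `&` [set x] != set0] = 0%E.
Variable E : nat -> set S.
Hypothesis sepE : separating E.

Lemma pr_avoid_point C : measurable C -> (forall x y, C x -> C y -> x = y) -> v C = 1.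
Proof.
move=> mC atC; have mCpi := measurable_avoid mC.
suff : pr P (~` avoid C) = 0 by rewrite pr_setC// => /eqP; rewrite subr_eq0 => /eqP.
have [->|/set0P[x Cx]] := eqVneq C set0.
  rewrite (_ : ~` avoid set0 = set0) ?/pr ?measure0//.
  by apply/seteqP; split=> // w; apply; exact: classical_sets.setI0.
have <- : [set x] = C by apply/seteqP; split=> [_ ->//|y Cy]; exact: atC.
rewrite /pr (_ : ~` _ = [set w | pi w `&` [set x] != set0]) ?null_pi//.
by apply/seteqP; split=> w /eqP.
Qed.

(** As [B n] shrinks, the events of avoiding [A \ B n] decrease to that of avoiding [A \ C], where
    [C] is the intersection. Since [C] has at most one point, removing it does not change [v A]. *)
Lemma pr_avoid_cvg A (B : nat -> set S) : measurable A ->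
  (forall n, measurable (B n)) -> nonincreasing_seq B ->
  (forall x y, (forall n, B n x) -> (forall n, B n y) -> x = y) ->
  (fun n => v (A `\` B n)) @ \oo --> v A.
Proof.
move=> mA mB decB atB; pose C := \bigcap_n B n.
have mC : measurable C by exact: bigcapT_measurable.
have vAC : v (A `&` C) = 1.
  apply: pr_avoid_point => [|x y [_ Cx] [_ Cy]]; first exact: measurableI.
  by apply: atB => n; [exact: Cx|exact: Cy].
rewrite (pr_avoid_split mA mC) vAC mul1r /v.
have -> : avoid (A `\` C) = \bigcap_n avoid (A `\` B n).
  apply/seteqP; split=> w.
    move=> piAC n _; rewrite /avoid /mkset -classical_sets.subset0 -piAC.
    by move=> x [pix [Ax nB]]; split=> //; split=> // Cx; apply/nB/Cx.
  move=> piAB; rewrite /avoid /mkset -classical_sets.subset0 => x [pix [Ax nC]].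
  apply: nC => n _; apply: contrapT => nB.
  by have : (pi w `&` (A `\` B n)) x by []; rewrite (piAB n I).
apply: pr_cvg => [n|]; first by apply: measurable_avoid; exact: measurableD.
apply/nonincreasing_seqP => n; apply/subsetPset => w.
rewrite /avoid /mkset => Aw; rewrite -classical_sets.subset0 -Aw.
apply: classical_sets.setIS; apply: classical_sets.setDS.
by apply/subsetPset; exact: decB.
Qed.

Let c n A t := v (cell (code E n) A t).
Arguments c : clear implicits.

Lemma measurable_code_cell n A t : measurable A -> measurable (cell (code E n) A t).
Proof. by move=> mA; apply: measurableI => //; exact: measurable_code. Qed.

(* Otherwise the void probability would stay away from 1 along a branch of
   cells shrinking to at most one point, although v(A \ B_n) tends to v(A) > 0. *)
Lemma code_cells_small A (q : R) : measurable A -> 0 < v A -> q < 1 ->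
  exists n, forall m, (n <= m)%N -> forall t, q < c m A t.
Proof.
move=> mA vA0 q1.
pose fine_cells B n := forall t, q < c n B t.
(* A level-[m] cell contained in [B] lies in a level-[n] cell of [B], and [v] is antitone. Allowing
   [B'] to differ from [B] covers both refinement and the passage from a half of a set to the
   whole. *)
have fine_leq B B' n m : measurable B -> measurable B' -> (n <= m)%N ->
    fine_cells B n -> forall x, cell (code E m) B' (code E m x) `<=` B ->
    q < c m B' (code E m x).
  move=> mB mB' nm fB x sub.
  apply: (lt_le_trans (fB (code E n x))); apply: pr_avoid_le.
  - exact: measurable_code_cell.
  - exact: measurable_code_cell.
  - by move=> y yB; split; [exact: sub|apply: code_leq nm yB.2].
have cell_empty m B t : measurable B -> (forall x, code E m x <> t) -> q < c m B t.
  move=> mB ne; rewrite /c pr_avoid_point//; first exact: measurable_code_cell.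
  by move=> x y [_ /ne].
have fine_mono B n m : measurable B -> (n <= m)%N -> fine_cells B n -> fine_cells B m.
  move=> mB nm fB t; have [[x <-]|/forallNP ne] := pselect (exists x, code E m x = t).
    by apply: (fine_leq B B n m) => // y [].
  exact: cell_empty.
apply: contrapT => bad; pose bad_set B := forall n, ~ fine_cells B n.
have badA : bad_set A by move=> n fA; apply: bad; exists n => m nm; exact: fine_mono fA.
have [|B [mBA badB decB atB]] := separating_branch sepE mA badA.
  move=> B i mB BA badB; apply: contrapT => /not_orP[].
  move=> /existsNP[n1 /contrapT f1] /existsNP[n2 /contrapT f2].
  (* A level beyond [n1] and [n2] keeps both halves fine; being at least [i.+1], it also makes the
     code record membership in [E i], so every cell lies in one half. *)
  apply: (badB (maxn i.+1 (maxn n1 n2))) => t; set m := maxn _ _.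
  have [mi m1 m2] : [/\ i < m, n1 <= m & n2 <= m]%N.
    by rewrite /m !leq_max !leqnn !orbT.
  have [[x <-]|/forallNP ne] := pselect (exists x, code E m x = t); last exact: cell_empty.
  have [Ex|nEx] := pselect (E i x).
    apply: (fine_leq (B `&` E i) B n1 m) => //.
      by apply: measurableI => //; exact: sepE.1.
    by move=> y [By /codeP/(_ i mi) [_ yE]]; split=> //; exact: yE.
  apply: (fine_leq (B `\` E i) B n2 m) => //.
    by apply: measurableD => //; exact: sepE.1.
  by move=> y [By /codeP/(_ i mi) [yE _]]; split=> //; move/yE.
have mB n : measurable (B n) by have [] := mBA n.
(* Already at level 0 some cell of [B n] has void probability at most [q], and [B n] contains that
   cell. *)
have vB n : v (B n) <= q.
  have /existsNP[t /negP] := badB n 0%N; rewrite -leNgt; apply: le_trans.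
  by apply: pr_avoid_le; [exact: measurable_code_cell|exact: mB|move=> x []].
(* The bound is the limit of [v A = v (B n) * v (A \ B n) <= q * v (A \ B n)]. *)
suff : v A <= q * v A by rewrite leNgt gtr_pMl// q1.
have lim : (fun n => q * v (A `\` B n)) @ \oo --> q * v A.
  by apply: cvgMl_tmp; exact: (pr_avoid_cvg mA mB decB atB).
apply: (cvgr_to_ge lim); apply: nearW => n.
have mAB : measurable (A `\` B n) by exact: measurableD.
rewrite (pr_avoid_split mA (mB n)) classical_sets.setIidr; last by have [] := mBA n.
by apply: ler_wpM2r => //; exact: pr_ge0.
Qed.

Let odds n A t := (c n A t)^-1 - 1.
Arguments odds : clear implicits.

Lemma pr_avoid_cell_bounds A n t : measurable A -> 0 < v A -> 0 < c n A t <= 1.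
Proof.
move=> mA vA0; have mc := @measurable_code_cell n A t mA.
rewrite pr_avoid_le1// andbT (lt_le_trans vA0)//.
by apply: pr_avoid_le => // x [].
Qed.

Lemma max_odds_cvg0 A : measurable A -> 0 < v A ->
  (fun n => \big[Order.max/0]_t odds n A t) @ \oo --> (0 : R).
Proof.
move=> mA vA0; apply/cvgr0Pnorm_lt => e e0.
have e1 : 0 < 1 + e / 2 by lra.
(* A void probability above [(1 + e / 2)^-1] means odds below [e / 2]. *)
have [|N NP] := @code_cells_small A (1 + e / 2)^-1 mA vA0.
  by rewrite invf_lt1//; lra.
exists N => // m /= /NP mP.
have max0 : 0 <= \big[Order.max/0]_t odds m A t by exact: bigmax_ge_id.
rewrite ger0_norm// (@le_lt_trans _ _ (e / 2))//; last by lra.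
apply: bigmax_le => [|t _]; first by lra.
have /andP[c0 _] := @pr_avoid_cell_bounds A m t mA vA0.
rewrite /odds lerBlDl invf_ple ?posrE//.
exact/ltW.
Qed.

(** The numbers [- ln c] of the cells add up to [- ln (v A)]. With [o = 1 / c - 1], the inequality
    [ln (1 + x) <= x] gives [- ln c = ln (1 + o) <= o] and also [o = (1 - c) * (1 + o) <= - ln c *
    (1 + beta n)], where [beta n] tends to 0. *)
Lemma sum_odds_cvg A : measurable A -> 0 < v A ->
  (fun n => \sum_t odds n A t) @ \oo --> - ln (v A).
Proof.
move=> mA vA0; pose beta n := \big[Order.max/0]_t odds n A t.
have lnvA n : - ln (v A) = \sum_t - ln (c n A t).
  rewrite (@pr_avoid_partition _ (code E n) A)//; last by move=> t; exact: measurable_code.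
  rewrite sumrN -[in RHS](expRK (\sum_t _)) expR_sum; congr (- ln _).
  apply: eq_bigr => t _; rewrite lnK// posrE.
  by have /andP[] := @pr_avoid_cell_bounds A n t mA vA0.
apply: (@squeeze_cvgr _ _ _ _ (fun=> - ln (v A)) (fun n => - ln (v A) * (1 + beta n))).
- apply: nearW => n; rewrite (lnvA n) mulr_suml.
  apply/andP; split; apply: ler_sum => t _.
    have /andP[c0 c1] := @pr_avoid_cell_bounds A n t mA vA0.
    rewrite -lnV ?posrE// -[X in ln X](subrKC 1).
    by rewrite le_ln1Dx// ltrBDl subrr invr_gt0.
  have /andP[c0 c1] := @pr_avoid_cell_bounds A n t mA vA0.
  have oE : odds n A t = (1 - c n A t) * (1 + odds n A t).
    by rewrite /odds; field; rewrite gt_eqF.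
  have o0 : 0 <= odds n A t by rewrite subr_ge0 invf_ge1.
  rewrite oE ler_pM//; [by rewrite subr_ge0|exact: addr_ge0| |].
  + rewrite lerNr opprB -[X in ln X](subrKC 1) le_ln1Dx// ltrBrDl subrr.
    exact: c0.
  + by rewrite lerD2l; exact: le_bigmax.
- exact: cvg_cst.
- rewrite -[X in _ --> X]mulr1 -[X in _ * X](addr0 1).
  apply: cvgMl_tmp; apply: cvgD; first exact: cvg_cst.
  exact: max_odds_cvg0.
Qed.

Lemma pr_below A k : measurable A -> 0 < v A ->
  pr P [set w | below k (Ncount A (pi w))] =
  v A * \sum_(i < k) (- ln (v A)) ^+ i / i`!%:R.
Proof.
move=> mA vA0.
have mcode n t : measurable (code E n @^-1` [set t]) by exact: measurable_code.
pose F n := [set w | (#|hits (code E n) A (pi w)| < k)%N].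
(* Points in distinct cells are distinct, and conversely any [k] distinct points lie in distinct
   cells at some level. *)
have -> : [set w | below k (Ncount A (pi w))] = \bigcap_n F n.
  apply/seteqP; split=> w.
    move=> Ak n _; rewrite /F /= ltnNge; apply: contraL Ak => /hits_geP[s [sk us sA]].
    by apply/Ncount_belowPn; exists s; split=> //; exact: map_uniq us.
  move=> Fw; apply: contraT => /Ncount_belowPn[s [sk us sA]].
  have [n un] := separating_code sepE us.
  have : (k <= #|hits (code E n) A (pi w)|)%N by apply/hits_geP; exists s.
  by rewrite leqNgt (Fw n I).
have mF n : measurable (F n) by exact: (pr_card_hits (mcode n) mA k vA0).1.
have decF : nonincreasing_seq F.
  move=> n m nm; apply/subsetPset => w; rewrite /F /= !ltnNge.
  apply: contra => /hits_geP[s [sk us sA]]; apply/hits_geP; exists s; split=> //.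
  exact: uniq_code_leq us.
suff lim : (fun n => pr P (F n)) @ \oo -->
    v A * \sum_(i < k) (- ln (v A)) ^+ i / i`!%:R.
  exact: cvg_unique (pr_cvg mF decF) lim.
under eq_fun => n do rewrite (pr_card_hits (mcode n) mA k vA0).2.
apply: cvgMl_tmp; apply: cvg_big => [|i _]; first exact: add_continuous.
apply: (elem_sym_cvg _ (max_odds_cvg0 mA vA0) (sum_odds_cvg mA vA0)) => n t.
have /andP[c0 c1] := @pr_avoid_cell_bounds A n t mA vA0.
by rewrite subr_ge0 invf_ge1// c1; exact: le_bigmax.
Qed.

(** Induction on [k], along a branch of sets with [v (B n) = 0]. If [A] holds at most [k] points,
    then either [A \ B n] holds none or [B n] holds fewer than [k]; the latter is a null event by
    induction, and the probability of the former tends to [v A = 0]. *)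
Lemma pr_below_eq0 A k : measurable A -> v A = 0 ->
  pr P [set w | below k (Ncount A (pi w))] = 0.
Proof.
elim: k A => [|k IH] A mA vA0.
  rewrite (_ : [set w | _] = set0) ?/pr ?measure0//.
  by apply/seteqP; split=> // w /=; case: Ncount.
have [|B [mBA vB decB atB]] := @separating_branch _ _ E (fun B => v B = 0) A sepE mA vA0.
  (* A vanishing product has a vanishing factor, so one half inherits void probability 0. *)
  move=> B n mB _ vB0; have := pr_avoid_split mB (sepE.1 n).
  by rewrite vB0 => /esym/eqP; rewrite mulf_eq0 => /orP[]/eqP; [left|right].
have mB n : measurable (B n) by have [] := mBA n.
apply/eqP; rewrite eq_le pr_ge0 andbT -vA0.
apply: (cvgr_to_ge (pr_avoid_cvg mA mB decB atB)); apply: nearW => n.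
have mav : measurable (avoid (A `\` B n)) by apply: measurable_avoid; exact: measurableD.
have mbe C j : measurable C -> measurable [set w | below j (Ncount C (pi w))].
  by move=> mC; exact: (@measurable_Ncount C (below j)).
rewrite -[leRHS]addr0 -(IH (B n) (mB n) (vB n)).
apply: le_trans _ (pr_setU_le P mav (mbe _ _ (mB n))).
apply: pr_le; [exact: mbe|by apply: measurableU => //; exact: mbe|].
move=> w /= Ak; have [|/eqP/set0P[x [pix [Ax nBx]]]] := pselect (avoid (A `\` B n) w).
  by left.
(* Otherwise [k] points in [B n], together with [x] outside it, would be [k.+1] points in [A]. *)
right; apply: contraT => /Ncount_belowPn[s [sk us sB]].
have /Ncount_belowPn/negP : exists s : seq S, [/\ size s = k.+1, uniq s &
    forall y, y \in s -> (pi w `&` A) y]; last by [].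
exists (x :: s); split=> /=; first by rewrite sk.
  by rewrite us andbT; apply/negP => /sB [_ /nBx].
move=> y; rewrite inE => /predU1P[->//|/sB[piy By]]; split=> //.
by have [_] := mBA n; exact.
Qed.

End null_points.

End process.

(** * Reading off the Poisson law *)

Theorem theorem1p11 (d dO : measure_display) (S : measurableType d)
  (Omega : measurableType dO) (R : realType) (P : probability Omega R)
  (pi : Omega -> set S) :
  measurable (diagonal : set (S * S)) ->
  crset pi -> constructive pi -> independent_increments P pi ->
  (forall x : S, P [set w | pi w `&` [set x] != set0] = 0%E) ->
  poisson_process P pi.

Proof.
move=> /diagonal_separating[E sepE] cr_pi _ indep_pi null_pi; split=> //; split=> // A mA.
have mNA B : measurable [set w | B (Ncount A (pi w))] by exact: measurable_Ncount.
have [vA0|vA_neq0] := eqVneq (pr P (avoid pi A)) 0.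
  right; rewrite (prE P (mNA [set None])); congr (_%:E).
  (* The count is infinite exactly when it is at least [k] for every [k]; these decreasing events
     all have probability 1. *)
  pose F k := ~` [set w | below k (Ncount A (pi w))].
  have mF k : measurable (F k) by apply: measurableC; exact: (mNA (below k)).
  have -> : [set w | Ncount A (pi w) = None] = \bigcap_k F k.
    apply/seteqP; split=> [w /= AN k _|w Fw /=]; first by rewrite /F /= AN.
    by case AN : Ncount (Fw) => [n|//] /(_ n.+1 I); rewrite /F /= AN /= ltnSn.
  have decF : nonincreasing_seq F.
    apply/nonincreasing_seqP => k; apply/subsetPset; apply: classical_sets.subsetC => w /=.
    by case: Ncount => //= n /ltnW.
  have lim : (fun k => pr P (F k)) @ \oo --> (1 : R).
    under eq_fun => k.
      rewrite pr_setC ?(@pr_below_eq0 _ _ _ _ _ _ _ cr_pi indep_pi null_pi E)// ?subr0.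
        over.
      exact: (mNA (below k)).
    exact: cvg_cst.
  exact: cvg_unique (pr_cvg mF decF) lim.
have vA_gt0 : 0 < pr P (avoid pi A) by rewrite lt0r vA_neq0 pr_ge0.
(* With this parameter [expR (- lam)] is [v A], the probability of no point in [A]. *)
left; exists (- ln (pr P (avoid pi A))); split.
  by rewrite oppr_ge0 ln_le0// pr_le1//; exact: measurable_avoid.
move=> k; rewrite (prE P (mNA [set Some k])) opprK lnK ?posrE//; congr (_%:E).
have below_law := @pr_below _ _ _ _ _ _ _ cr_pi indep_pi null_pi E sepE A.
have belowS : [set w | below k.+1 (Ncount A (pi w))] =
    [set w | below k (Ncount A (pi w))] `|` [set w | Ncount A (pi w) = Some k].
  apply/seteqP; split=> w /=; case: (Ncount A (pi w)) => [n|] /=.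
  - by rewrite ltnS leq_eqVlt => /predU1P[->|]; [right|left].
  - by [].
  - by move=> [/ltnW//|[->]].
  - by move=> [].
have disj : [set w | below k (Ncount A (pi w))] `&` [set w | Ncount A (pi w) = Some k] = set0.
  by rewrite -classical_sets.subset0 => w /= [] /[swap] ->; rewrite /= ltnn.
(* The mass at [k] is the difference of the laws of [below k.+1] and [below k], that is, the last
   term of the partial sum. *)
apply: (addrI (pr P [set w | below k (Ncount A (pi w))])).
rewrite -(pr_setU P (mNA (below k)) (mNA [set Some k]) disj) -belowS.
by rewrite !below_law// big_ord_recr /= mulrDr mulrA.
Qed.
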